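(* Let $S$ be an infinite set. The metric space $\mathcal{S}$ of simplicial complexes over $S$ is not locally compact.
   Context: $\mathcal{P}_f^*(S)$ is the collection of all non-empty finite subsets of $S$. A simplicial complex over $S$ is a non-empty collection $\mathcal{K}\subset\mathcal{P}_f^*(S)$ such that every non-empty subset of an element of $\mathcal{K}$ belongs to $\mathcal{K}$. $\Omega=[0,1]$ with Lebesgue measure $\lambda$. $L(\mathcal{K})$ is the set of measurable maps $f:\Omega\to S$, identified when equal almost everywhere, such that $f(\Omega)\in\mathcal{K}$, where $f(\Omega)$ denotes the set $\{s\in S : \lambda(f^{-1}(s))>0\}$ and $f$ takes its values in this set almost everywhere. The metric is $d(f,g)=\lambda(\{t\in\Omega : f(t)\neq g(t)\})$. The metric on $\mathcal{S}$ is the Hausdorff distance $d(\mathcal{K}_1,\mathcal{K}_2)=\max(\delta(\mathcal{K}_1,\mathcal{K}_2),\delta(\mathcal{K}_2,\mathcal{K}_1))$ with $\delta(\mathcal{K}_1,\mathcal{K}_2)=\sup_{f\in L(\mathcal{K}_1)}\inf_{g\in L(\mathcal{K}_2)}d(f,g)$. *)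

(* Defs.v *)
From HB Require Import structures.
From mathcomp Require Import all_boot all_order all_algebra.
From mathcomp Require Import all_classical all_reals all_analysis.

Set Implicit Arguments.
Unset Strict Implicit.
Unset Printing Implicit Defensive.

Import Order.TTheory GRing.Theory Num.Theory.
Import numFieldNormedType.Exports.

Local Open Scope classical_set_scope.
Local Open Scope ring_scope.
Local Open Scope quotient_scope.

Definition fin_nonempty_sets (S : Type) : set (set S) :=
  [set A | finite_set A /\ A !=set0].
Arguments fin_nonempty_sets : clear implicits.

(* Not every point of S has to be a vertex. *)
Record simplicial_complex (S : Type) := SimplicialComplex {
  simplices : set (set S) ;
  simplices_neq0 : simplices !=set0 ;
  simplices_fin : simplices `<=` fin_nonempty_sets S ;
  simplices_sub : forall A B : set S,
    simplices A -> B `<=` A -> B !=set0 -> simplices B }.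

Definition Omega (R : realType) : set R := `[0, 1].
Arguments Omega : clear implicits.

(* Measurable maps from Omega to the discrete space S. The values outside of
   Omega are junk, which the quotient below forgets. The sigma-algebra on Omega
   is the Borel one; using Lebesgue-measurable sets instead would not change
   the classes of maps that essentially take finitely many values. *)
Record omega_map (R : realType) (S : Type) := OmegaMap {
  omega_fun :> R -> S ;
  omega_mapP : forall A : set S, measurable (Omega R `&` omega_fun @^-1` A) }.

HB.instance Definition _ (R : realType) (S : Type) :=
  gen_eqMixin (omega_map R S).
HB.instance Definition _ (R : realType) (S : Type) :=
  gen_choiceMixin (omega_map R S).

Section ae_quotient.
Variables (R : realType) (S : Type).

Definition omega_ae_eq (f g : omega_map R S) : bool :=
  `[< (f : R -> S) = g %[ae @lebesgue_measure R in Omega R] >].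

Let omega_ae_eq_refl : reflexive omega_ae_eq.
Proof. by move=> f; apply/asboolP; exact: ae_eq_refl. Qed.

Let omega_ae_eq_sym : symmetric omega_ae_eq.
Proof. by move=> f g; apply/idP/idP => /asboolP h; apply/asboolP/ae_eq_sym. Qed.

Let omega_ae_eq_trans : transitive omega_ae_eq.
Proof. by move=> f g h /asboolP gf /asboolP fh; apply/asboolP/(ae_eq_trans gf fh). Qed.

Canonical omega_ae_eq_equiv :=
  EquivRel omega_ae_eq omega_ae_eq_refl omega_ae_eq_sym omega_ae_eq_trans.

Definition ae_map : Type := {eq_quot omega_ae_eq}.
HB.instance Definition _ := Choice.on ae_map.
HB.instance Definition _ := EqQuotient.on ae_map.

Definition ae_map_fun (f : ae_map) : R -> S := (repr f : omega_map R S).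
Coercion ae_map_fun : ae_map >-> Funclass.

End ae_quotient.

Section random_simplices.
Variables (R : realType) (S : Type).
Implicit Types (f g h : ae_map R S) (K : simplicial_complex S).

Definition ess_image f : set S :=
  [set s | (0 < lebesgue_measure (Omega R `&` f @^-1` [set s]))%E].

Definition L K : set (ae_map R S) :=
  [set f | simplices K (ess_image f) /\
    \forall t \ae @lebesgue_measure R, Omega R t -> ess_image f (f t)].

(* lebesgue_measure is an outer measure, so this makes sense even when the set
   is not known to be measurable; it is Lebesgue-measurable when f and g
   essentially take finitely many values. *)
Definition L_dist f g : R :=
  fine (lebesgue_measure [set t | Omega R t /\ f t <> g t]).

Definition L_delta K1 K2 : R :=
  sup [set inf [set L_dist f g | g in L K2] | f in L K1].

Definition complex_dist K1 K2 : R := Num.max (L_delta K1 K2) (L_delta K2 K1).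

Let leb_le (A B : set R) : A `<=` B ->
  (lebesgue_measure A <= lebesgue_measure B)%E.
Proof. by move=> AB; rewrite /lebesgue_measure; exact: le_mu_ext. Qed.

Let leb_ge0 (A : set R) : (0 <= lebesgue_measure A)%E.
Proof. by rewrite /lebesgue_measure; exact: mu_ext_ge0. Qed.

Let lebU (A B : set R) :
  (lebesgue_measure (A `|` B) <= lebesgue_measure A + lebesgue_measure B)%E.
Proof. by rewrite /lebesgue_measure; exact: outer_measureU2. Qed.

Let leb_Omega : lebesgue_measure (Omega R) = 1%E.
Proof. by rewrite /Omega lebesgue_measure_itv/= lte_fin ltr01 oppr0 adde0. Qed.

Let L_distE f g :
  lebesgue_measure [set t | Omega R t /\ f t <> g t] = (L_dist f g)%:E.
Proof.
rewrite /L_dist fineK// ge0_fin_numE//; apply: (@le_lt_trans _ _ 1%E).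
  by rewrite -leb_Omega; apply: leb_le => t [].
by rewrite ltry.
Qed.

Lemma L_dist_ge0 f g : 0 <= L_dist f g.
Proof. by rewrite -lee_fin -L_distE. Qed.

Lemma L_dist_le1 f g : L_dist f g <= 1.
Proof. by rewrite -lee_fin -L_distE -leb_Omega; apply: leb_le => t []. Qed.

Lemma L_distxx f : L_dist f f = 0.
Proof.
rewrite /L_dist (_ : [set t | _] = set0) ?measure0//.
by rewrite -subset0 => t [].
Qed.

Lemma L_dist_sym f g : L_dist f g = L_dist g f.
Proof.
by rewrite /L_dist; congr (fine (_ _)); apply/seteqP; split => t [Ot fg];
  split => // /esym.
Qed.

Lemma L_dist_triangle g f h : L_dist f h <= L_dist f g + L_dist g h.
Proof.
rewrite -lee_fin EFinD -!L_distE; apply: le_trans (lebU _ _).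
apply: leb_le => t [Ot fh]; case: (pselect (f t = g t)) => fg; [right|left] => //.
by split => //; rewrite -fg.
Qed.

Let leb_ae_le (m1 m2 : R -> S) (B : set S) :
  m1 = m2 %[ae @lebesgue_measure R in Omega R] ->
  (lebesgue_measure (Omega R `&` m1 @^-1` B) <=
   lebesgue_measure (Omega R `&` m2 @^-1` B))%E.
Proof.
move=> [N [_ N0 sN]].
apply: (@le_trans _ _ (lebesgue_measure (Omega R `&` m2 @^-1` B `|` N))).
  apply: leb_le => t [Ot Bt].
  have [e|ne] := pselect (m1 t = m2 t); [left|right].
    by split => //=; rewrite -e.
  by apply: sN => /= /(_ Ot).
by apply: le_trans (lebU _ _) _; rewrite N0 adde0.
Qed.

Let repr_pi_ae (m : omega_map R S) :
  (\pi_(ae_map R S) m : ae_map R S) = m %[ae @lebesgue_measure R in Omega R].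
Proof.
suff /asboolP : omega_ae_eq (repr (\pi_(ae_map R S) m)) m by [].
by apply/eqmodP; exact: reprK.
Qed.

Let leb_pi (m : omega_map R S) (B : set S) :
  lebesgue_measure (Omega R `&` (\pi_(ae_map R S) m : ae_map R S) @^-1` B) =
  lebesgue_measure (Omega R `&` m @^-1` B).
Proof.
by apply/eqP; rewrite eq_le; apply/andP; split; apply: leb_ae_le;
  [exact: repr_pi_ae|apply: ae_eq_sym; exact: repr_pi_ae].
Qed.

Let finite_enum (A : set S) : finite_set A -> A !=set0 ->
  exists n (h : nat -> S), (forall i, A (h i)) /\
    (forall s, A s -> exists2 i, (i < n)%N & h i = s).
Proof.
move=> /(@finite_seqP {classic S})[l ->] [x0 lx0].
exists (size l), (fun i => nth (x0 : {classic S}) l i); split.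
  move=> i /=; have [il|li] := ltnP i (size l); first exact: mem_nth.
  by rewrite nth_default.
move=> s /= sl; exists (index (s : {classic S}) l); first by rewrite index_mem.
exact: (@nth_index {classic S}).
Qed.

(* Any finite non-empty set is the essential image of a step function which
   takes each value on a set of measure bounded below. *)
Let step_map (A : set S) : finite_set A -> A !=set0 ->
  exists2 m : omega_map R S, (forall t, A (m t)) &
    exists2 e : R, 0 < e & forall s, A s ->
      (e%:E <= lebesgue_measure (Omega R `&` m @^-1` [set s]))%E.
Proof.
move=> finA A0; have [n [h [Ah hA]]] := finite_enum finA A0.
have n0 : (0 < n)%N.
  by case: A0 => s /hA[i]; case: n {hA}.
have n0R : 0 < n%:R :> R by rewrite ltr0n.
pose k (t : R) := Num.truncn (n%:R * t).
pose I i : set R := `[i%:R / n%:R, i.+1%:R / n%:R[%classic.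
have kI i t : Omega R t -> (k t = i <-> I i t).
  rewrite /Omega/= in_itv/= => /andP[t0 _].
  have nt0 : 0 <= n%:R * t by rewrite mulr_ge0.
  rewrite /I/= in_itv/= ler_pdivrMr// ltr_pdivlMr// (mulrC t) -truncn_eq//.
  by split => /eqP.
have mh (B : set S) : measurable (Omega R `&` (h \o k) @^-1` B).
  rewrite (_ : _ `&` _ = \bigcup_(i in [set i | B (h i)]) (Omega R `&` I i)).
    apply: bigcup_measurable => i _; apply: measurableI;
      exact: measurable_itv.
  apply/seteqP; split => [t [Ot Bt]|t [i /= Bi [Ot It]]].
    by exists (k t) => //; split => //; exact/(kI _ _ Ot).
  by split => //=; move/(kI _ _ Ot) : It => ->.
exists (OmegaMap mh) => [t /=|]; first exact: Ah.
exists n%:R^-1; first by rewrite invr_gt0.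
move=> s /hA[i iltn <-].
have -> : n%:R^-1%:E = lebesgue_measure (I i).
  rewrite /I lebesgue_measure_itv/= lte_fin ltr_pM2r ?invr_gt0// ltr_nat ltnSn.
  by rewrite -EFinB -mulrBl -natrB// subSnn mul1r.
apply: leb_le => t It.
have Ot : Omega R t.
  move: It; rewrite /I /Omega/= !in_itv/= => /andP[it ti]; apply/andP; split.
    by apply: le_trans it; rewrite divr_ge0.
  by apply: le_trans (ltW ti) _; rewrite ler_pdivrMr// mul1r ler_nat.
by split => //=; move/(kI _ _ Ot) : It => ->.
Qed.

Lemma L_step K (A : set S) : simplices K A -> exists2 f, L K f &
  exists2 e : R, 0 < e & forall s, A s ->
    (e%:E <= lebesgue_measure (Omega R `&` f @^-1` [set s]))%E.
Proof.
move=> KA; have [finA A0] := simplices_fin KA.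
have [m Am [e e0 em]] := step_map finA A0.
have fE : forall s, A s ->
    (e%:E <= lebesgue_measure (Omega R `&` (\pi_(ae_map R S) m : ae_map R S) @^-1` [set s]))%E.
  by move=> s As; rewrite leb_pi; exact: em.
have imA : ess_image (\pi_(ae_map R S) m) = A.
  apply/seteqP; split => s /=; last first.
    by move=> As; apply: lt_le_trans (fE s As); rewrite lte_fin.
  rewrite /ess_image/= leb_pi => ms; apply: contrapT => nAs.
  move: ms; rewrite (_ : _ `&` _ = set0) ?measure0 ?ltxx//.
  by rewrite -subset0 => t [_ /= mt]; apply: nAs; rewrite -mt.
exists (\pi_(ae_map R S) m); last by exists e.
split; first by rewrite imA.
rewrite imA; have := repr_pi_ae m; apply: negligibleS => t /= nAt mt.
by apply: nAt => Ot; rewrite (mt Ot).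
Qed.

Lemma L_neq0 K : L K !=set0.
Proof.
by have [A KA] := simplices_neq0 K; have [f Lf _] := L_step KA; exists f.
Qed.

Let dist_to K f := inf [set L_dist f g | g in L K].

Let dist_to_has_inf K f : has_inf [set L_dist f g | g in L K].
Proof.
split; first by have [g Lg] := L_neq0 K; exists (L_dist f g), g.
by exists 0 => _ [g _ <-]; exact: L_dist_ge0.
Qed.

Let dist_to_le K f g : L K g -> dist_to K f <= L_dist f g.
Proof.
by move=> Kg; apply: ge_inf; [have [] := dist_to_has_inf K f|exists g].
Qed.

Let delta_has_sup K1 K2 : has_sup [set dist_to K2 f | f in L K1].
Proof.
split; first by have [f Lf] := L_neq0 K1; exists (dist_to K2 f), f.
exists 1 => _ [f _ <-]; have [g Lg] := L_neq0 K2.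
exact: le_trans (dist_to_le _ Lg) (L_dist_le1 _ _).
Qed.

Let dist_to_delta K1 K2 f : L K1 f -> dist_to K2 f <= L_delta K1 K2.
Proof.
by move=> Kf; apply: ub_le_sup; [have [] := delta_has_sup K1 K2|exists f].
Qed.

Let L_delta_near K1 K2 f e : L K1 f -> 0 < e ->
  exists2 g, L K2 g & L_dist f g < L_delta K1 K2 + e.
Proof.
move=> Kf e0; have [||_ [g Kg <-] fg] := @inf_lt _
    [set L_dist f g | g in L K2] (L_delta K1 K2 + e).
- by have [] := dist_to_has_inf K2 f.
- by apply: le_lt_trans (dist_to_delta K2 Kf) _; rewrite ltrDl.
- by exists g.
Qed.

Lemma L_delta_triangle K2 K1 K3 :
  L_delta K1 K3 <= L_delta K1 K2 + L_delta K2 K3.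
Proof.
apply: ge_sup; first by have [] := delta_has_sup K1 K3.
move=> _ [f Kf <-]; apply/ler_addgt0Pr => e e0.
have e20 : 0 < e / 2 by rewrite divr_gt0.
have [g Kg fg] := L_delta_near K2 Kf e20.
have [h Kh gh] := L_delta_near K3 Kg e20.
rewrite [e in leRHS]splitr addrACA.
apply: le_trans (dist_to_le _ Kh) _; apply: le_trans (L_dist_triangle g _ _) _.
by rewrite lerD// ltW.
Qed.

Lemma L_delta_ge0 K1 K2 : 0 <= L_delta K1 K2.
Proof.
have [f Kf] := L_neq0 K1; apply: le_trans (dist_to_delta K2 Kf).
apply: lb_le_inf; first by have [] := dist_to_has_inf K2 f.
by move=> _ [g _ <-]; exact: L_dist_ge0.
Qed.

Lemma L_deltaxx K : L_delta K K = 0.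
Proof.
apply/eqP; rewrite eq_le L_delta_ge0 andbT.
apply: ge_sup; first by have [] := delta_has_sup K K.
by move=> _ [f Kf <-]; rewrite -(L_distxx f); exact: dist_to_le.
Qed.

Lemma L_delta_eq0 K1 K2 : L_delta K1 K2 = 0 -> simplices K1 `<=` simplices K2.
Proof.
move=> d0 A KA; have [f Kf [e e0 fe]] := L_step KA.
have [g [Kg _]] := L_delta_near K2 Kf e0; rewrite d0 add0r => fg.
apply: (simplices_sub Kg); last by have [] := simplices_fin KA.
move=> s As; rewrite /ess_image/=; rewrite ltNge; apply/negP => gs.
have := fg; rewrite ltNge => /negP; apply.
rewrite -lee_fin; apply: le_trans (fe s As) _; rewrite -L_distE.
apply: (@le_trans _ _ (lebesgue_measure (Omega R `&` g @^-1` [set s] `|`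
    [set t | Omega R t /\ f t <> g t]))).
  apply: leb_le => t [Ot /= ft]; have [e'|ne] := pselect (f t = g t).
    by left; split => //=; rewrite -e'.
  by right.
apply: le_trans (lebU _ _) _; rewrite -[leRHS]add0e.
exact: leeD2r.
Qed.

Lemma complex_distxx K : complex_dist K K = 0.
Proof. by rewrite /complex_dist maxxx L_deltaxx. Qed.

Lemma complex_dist_sym K1 K2 : complex_dist K1 K2 = complex_dist K2 K1.
Proof. by rewrite /complex_dist maxC. Qed.

Lemma complex_dist_triangle K2 K1 K3 :
  complex_dist K1 K3 <= complex_dist K1 K2 + complex_dist K2 K3.
Proof.
rewrite /complex_dist ge_max; apply/andP; split.
  apply: le_trans (L_delta_triangle K2 _ _) _.
  by apply: lerD; rewrite le_max lexx.
apply: le_trans (L_delta_triangle K2 _ _) _; rewrite addrC.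
by apply: lerD; rewrite le_max lexx orbT.
Qed.

Lemma complex_dist_eq0 K1 K2 : complex_dist K1 K2 = 0 -> K1 = K2.
Proof.
move=> /eqP; rewrite eq_le ge_max => /andP[/andP[d12 d21] _].
have {d12}d12 : L_delta K1 K2 = 0 by apply/eqP; rewrite eq_le d12 L_delta_ge0.
have {d21}d21 : L_delta K2 K1 = 0 by apply/eqP; rewrite eq_le d21 L_delta_ge0.
have : simplices K1 = simplices K2 by apply/seteqP; split; exact: L_delta_eq0.
case: K1 K2 {d12 d21} => [s1 a1 b1 c1] [s2 a2 b2 c2] /= s12.
by subst s2; congr SimplicialComplex; exact: Prop_irrelevance.
Qed.

End random_simplices.

(* The phantom parameter R is the field in which the distance takes its
   values. *)
Definition complex_space (R : realType) (S : Type) : Type :=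
  simplicial_complex S.

HB.instance Definition _ (R : realType) (S : Type) :=
  gen_eqMixin (complex_space R S).
HB.instance Definition _ (R : realType) (S : Type) :=
  gen_choiceMixin (complex_space R S).
HB.instance Definition _ (R : realType) (S : Type) :=
  @isMetric.Build R (complex_space R S) (@complex_dist R S)
    (@complex_distxx R S) (@complex_dist_eq0 R S) (@complex_dist_sym R S)
    (@complex_dist_triangle R S).

(* Main.v *)
Require Import Defs.
From mathcomp Require Import all_boot all_order all_algebra.
From mathcomp Require Import all_classical all_reals all_analysis.
From mathcomp Require Import zify.
Local Open Scope classical_set_scope.

Set Implicit Arguments.
Unset Strict Implicit.
Unset Printing Implicit Defensive.

Import Order.TTheory GRing.Theory Num.Theory.

Local Open Scope ring_scope.
Local Open Scope quotient_scope.

(** The complex K0 of all non-empty finite subsets of S has no compact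
neighbourhood.

Forbidding one large simplex hardly moves K0: let T be a set of n >= 2 points
and let K(T) be the complex of the non-empty finite sets that do not contain T.
For a random simplex f, the n points of T carry disjoint events in a space of
total mass 1, so some point t0 of T has mass at most 1/n. Replacing the value
t0 by any other value changes f on a set of measure at most 1/n and produces a
random simplex of K(T) ([avoiding_near]). Hence d(K0, K(T)) <= 1/n.

On the other hand two such complexes stay apart. Take T_i to be the window
{x_i, ..., x_(i+n-1)} of an injective sequence x in S; distinct windows are not
contained in one another. A random simplex f with image T_i then belongs to
K(T_j) for j <> i, and any random simplex of K(T_i) misses some point t of T_i,
so that it is at distance at least the mass of t under f. Relabelling a fixed
random simplex with image T_0 gives, for each i, an f with image T_i whose
masses have a lower bound e > 0 that does not depend on i
([avoiding_windows_separated]).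

Every ball around K0 thus contains an infinite sequence of points at mutual
distance at least e, which [compact_not_separated] excludes in a compact set.

Both constructions change a random simplex by composing it with a map of S;
[L_postcomp] and [mass_postcomp] describe the effect of such a composition on
simplices and on masses. *)

(** * Separated sequences in metric spaces *)

(** A cluster point p of the sequence has terms of index as large as one likes
within e/2; two of them with different indices are at distance less than e. *)
Lemma compact_not_separated (R : realType) (T : metricType R) (U : set T)
    (u : nat -> T) (e : R) :
  0 < e -> (forall i, U (u i)) ->
  (forall i j, i <> j -> e <= mdist (u i) (u j)) -> ~ compact U.
Proof.
move=> e0 Uu sep /(_ (u @ \oo) _)[|p [_ clp]].
  by apply: (@filterE _ \oo) => i; exact: Uu.
have tail k : exists2 i, (k <= i)%N & ball p (e / 2) (u i).
  have [||_ [[i ki <-] pi]] :=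
      clp [set u i | i in [set i | (k <= i)%N]] (ball p (e / 2)).
  - by exists k => // i ki; exists i.
  - by apply: nbhsx_ballx; rewrite divr_gt0.
  by exists i.
have [i _ pi] := tail 0%N; have [j ij pj] := tail i.+1.
have /sep : i <> j by move=> e'; rewrite e' ltnn in ij.
rewrite leNgt => /negP; apply.
by have := ball_splitr pi pj; rewrite ballEmdist.
Qed.

(** * Masses of almost everywhere defined maps *)

Lemma le_lebesgue (R : realType) (A B : set R) : A `<=` B ->
  (lebesgue_measure A <= lebesgue_measure B)%E.
Proof. by move=> AB; rewrite /lebesgue_measure; exact: le_mu_ext. Qed.

Lemma lebesgue_Omega (R : realType) : lebesgue_measure (Omega R) = 1%E.
Proof. by rewrite /Omega lebesgue_measure_itv/= lte_fin ltr01 oppr0 adde0. Qed.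

Lemma lebesgueU_negligible (R : realType) (A N : set R) :
  (@lebesgue_measure R).-negligible N ->
  (lebesgue_measure (A `|` N) <= lebesgue_measure A)%E.
Proof.
move=> [N' [_ N0 NN']]; apply: (@le_trans _ _ (lebesgue_measure (A `|` N'))).
  exact/le_lebesgue/setUS.
rewrite -[leRHS]adde0 -N0 /lebesgue_measure; exact: outer_measureU2.
Qed.

Lemma lebesgue_L_distE (R : realType) (S : Type) (f g : ae_map R S) :
  lebesgue_measure [set t | Omega R t /\ f t <> g t] = (L_dist f g)%:E.
Proof.
rewrite /L_dist fineK// ge0_fin_numE; last first.
  by rewrite /lebesgue_measure; exact: mu_ext_ge0.
apply: (@le_lt_trans _ _ 1%E); last by rewrite ltry.
by rewrite -lebesgue_Omega; apply: le_lebesgue => t [].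
Qed.

Definition mass (R : realType) (S : Type) (f : R -> S) (B : set S) : \bar R :=
  lebesgue_measure (Omega R `&` f @^-1` B).

Lemma mass_ge0 (R : realType) (S : Type) (f : R -> S) (B : set S) :
  (0 <= mass f B)%E.
Proof. by rewrite /mass /lebesgue_measure; exact: mu_ext_ge0. Qed.

Lemma le_mass (R : realType) (S : Type) (f : R -> S) (A B : set S) :
  A `<=` B -> (mass f A <= mass f B)%E.
Proof. by move=> AB; apply: le_lebesgue; apply: setIS => t; exact: AB. Qed.

Lemma le_mass_ae (R : realType) (S S' : Type) (f : R -> S) (g : R -> S')
    (A : set S) (B : set S') :
  (\forall t \ae @lebesgue_measure R, Omega R t -> A (f t) -> B (g t)) ->
  (mass f A <= mass g B)%E.
Proof.
move=> fg; apply: le_trans (lebesgueU_negligible _ fg); apply: le_lebesgue.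
move=> t [Ot At]; have [Bt|Bt] := pselect (B (g t)); first by left.
by right => /= /(_ Ot At).
Qed.

Lemma ess_imageP (R : realType) (S : Type) (f : ae_map R S) (s : S) :
  ess_image f s = (0 < mass f [set s])%E.
Proof. by []. Qed.

(** Off a negligible set, g never takes the value s, so f and g differ wherever f
takes it. *)
Lemma le_mass_L_dist (R : realType) (S : Type) (f g : ae_map R S) (s : S) :
  ~ ess_image g s -> (mass f [set s] <= (L_dist f g)%:E)%E.
Proof.
move=> gs; have ms : (@lebesgue_measure R).-negligible (Omega R `&` g @^-1` [set s]).
  apply/negligibleP; first exact: omega_mapP.
  apply/eqP; rewrite eq_le [X in _ && X]mass_ge0 andbT leNgt.
  exact/negP.
rewrite -lebesgue_L_distE; apply: le_trans (lebesgueU_negligible _ ms).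
apply: le_lebesgue => t [Ot ft]; have [gt|gt] := pselect (g t = s).
  by right; split.
by left; split => //; rewrite ft => /esym.
Qed.

(** The n events are disjoint and their masses add up to at most 1. *)
Lemma small_mass (R : realType) (S : Type) (f : ae_map R S) (x : nat -> S)
    (n : nat) : injective x -> (0 < n)%N ->
  exists2 k, (k < n)%N & (mass f [set x k] <= n%:R^-1%:E)%E.
Proof.
move=> xinj n0; apply: contrapT => nex.
pose F k := Omega R `&` f @^-1` [set x k].
have big k : (k < n)%N -> (n%:R^-1%:E < mass f [set x k])%E.
  by move=> kn; rewrite ltNge; apply/negP => h; apply: nex; exists k.
have fin k : mass f [set x k] = (fine (mass f [set x k]))%:E.
  rewrite fineK// ge0_fin_numE ?mass_ge0// (@le_lt_trans _ _ 1%E) ?ltry//.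
  by rewrite -lebesgue_Omega; apply: le_lebesgue => t [].
have : (lebesgue_measure (\big[setU/set0]_(k < n) F k) <= 1 :> \bar R)%E.
  rewrite -lebesgue_Omega; apply: le_lebesgue => t.
  by rewrite -bigcup_mkord => -[k _ []].
rewrite measure_semi_additive//; last 3 first.
- by move=> k; exact: omega_mapP.
- apply/trivIsetP => i j _ _ /eqP ij; rewrite -subset0 => t [[_ /= fi] [_ /= fj]].
  by apply: ij; apply: xinj; rewrite -fi -fj.
- by apply: bigsetU_measurable => k _; exact: omega_mapP.
apply/negP; rewrite -ltNge.
rewrite (eq_bigr (fun k : 'I_n => (fine (mass f [set x k]))%:E)); last first.
  by move=> k _; rewrite -fin.
rewrite sumEFin lte_fin [ltLHS](_ : _ = \sum_(k < n) n%:R^-1); last first.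
  by rewrite sumr_const card_ord -(mulr_natl n%:R^-1) mulfV// pnatr_eq0 -lt0n.
apply: ltr_sum => [|k _].
  by apply/hasP; exists (Ordinal n0); rewrite ?mem_index_enum.
by rewrite -lte_fin -fin big.
Qed.

(** * Postcomposition *)

Definition postcomp (R : realType) (S S' : Type) (r : S -> S')
    (f : ae_map R S) : ae_map R S' :=
  \pi_(ae_map R S')
    (@OmegaMap R S' (r \o f) (fun A => omega_mapP (repr f) (r @^-1` A))).

Lemma postcompE (R : realType) (S S' : Type) (r : S -> S') (f : ae_map R S) :
  postcomp r f = r \o f %[ae @lebesgue_measure R in Omega R].
Proof.
rewrite /postcomp; set m := OmegaMap _.
suff /asboolP : omega_ae_eq (repr (\pi_(ae_map R S') m)) m by [].
by apply/eqmodP; exact: reprK.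
Qed.

Lemma mass_postcomp (R : realType) (S S' : Type) (r : S -> S')
    (f : ae_map R S) (B : set S') :
  mass (postcomp r f) B = mass f (r @^-1` B).
Proof.
apply/eqP; rewrite eq_le; apply/andP; split; apply: le_mass_ae;
  by have := postcompE r f; apply: (@filterS _ _ (ae_filter_ringOfSetsType _)) => t + Ot => /(_ Ot) ->.
Qed.

(** The hypothesis excludes diffuse parts of f: if r merged infinitely many
null values into one, that value could acquire positive mass without coming
from the essential image. *)
Lemma ess_image_postcomp (R : realType) (S S' : Type) (r : S -> S')
    (f : ae_map R S) :
  (\forall t \ae @lebesgue_measure R, Omega R t -> ess_image f (f t)) ->
  ess_image (postcomp r f) = r @` ess_image f.
Proof.
move=> aef; apply/seteqP; split => [s|_ [s fs <-]]; last first.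
  rewrite ess_imageP mass_postcomp; apply: lt_le_trans fs _.
  by apply: le_mass => _ ->.
rewrite ess_imageP mass_postcomp => ms; apply: contrapT => nim.
move: ms; apply/negP; rewrite -leNgt.
apply: (@le_trans _ _ (mass f set0)).
  apply: le_mass_ae; apply: (@filterS _ _ (ae_filter_ringOfSetsType _)) aef => t + Ot => /(_ Ot) ft /= rs.
  by apply: nim; exists (f t).
by rewrite /mass preimage_set0 setI0 measure0.
Qed.

Lemma L_postcomp (R : realType) (S S' : Type) (r : S -> S')
    (K : simplicial_complex S) (K' : simplicial_complex S') (f : ae_map R S) :
  L K f -> simplices K' (r @` ess_image f) -> L K' (postcomp r f).
Proof.
move=> [_ aef] K'rf; split; rewrite (ess_image_postcomp r aef)//.
have := postcompE r f; move: aef.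
apply: (@filterS2 _ _ (ae_filter_ringOfSetsType _)) => t + + Ot.
by move=> /(_ Ot) ft /(_ Ot) ->; exists (f t).
Qed.

(** The two maps can differ only where f takes its values in B, the part of S
that r may move. *)
Lemma L_dist_postcomp_le (R : realType) (S : Type) (r : S -> S)
    (f : ae_map R S) (B : set S) :
  (forall s, ~ B s -> r s = s) ->
  ((L_dist f (postcomp r f))%:E <= mass f B)%E.
Proof.
move=> rB; rewrite -lebesgue_L_distE.
apply: le_trans (lebesgueU_negligible _ (postcompE r f)).
apply: le_lebesgue => t [Ot ne].
have [e|ne'] := pselect (postcomp r f t = (r \o f) t); [left|right]; last first.
  by move=> /= /(_ Ot).
split => //=; apply: contrapT => /rB rf; apply: ne; rewrite e /=.
by rewrite rf.
Qed.

(** * One-sided Hausdorff distances *)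

Lemma inf_L_dist_le (R : realType) (S : Type) (K : simplicial_complex S)
    (f g : ae_map R S) :
  L K g -> inf [set L_dist f h | h in L K] <= L_dist f g.
Proof.
move=> Kg; apply: ge_inf; last by exists g.
by exists 0 => _ [h _ <-]; exact: L_dist_ge0.
Qed.

Lemma L_delta_le (R : realType) (S : Type) (K1 K2 : simplicial_complex S)
    (e : R) :
  (forall f, L K1 f -> exists2 g : ae_map R S, L K2 g & L_dist f g <= e) ->
  L_delta R K1 K2 <= e.
Proof.
move=> near; apply: ge_sup.
  by have [f Kf] := L_neq0 R K1; eexists; exists f.
move=> _ [f /near[g Kg fg] <-]; exact: le_trans (inf_L_dist_le f Kg) fg.
Qed.

Lemma le_L_delta (R : realType) (S : Type) (K1 K2 : simplicial_complex S)
    (f : ae_map R S) (e : R) :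
  L K1 f -> (forall g, L K2 g -> e <= L_dist f g) -> e <= L_delta R K1 K2.
Proof.
move=> Kf far; apply: (@le_trans _ _ (inf [set L_dist f g | g in L K2])).
  apply: lb_le_inf; first by have [g Kg] := L_neq0 R K2; eexists; exists g.
  by move=> _ [g Kg <-]; exact: far.
apply: ub_le_sup; last by exists f.
exists 1 => _ [h _ <-]; have [g Kg] := L_neq0 R K2.
exact: le_trans (inf_L_dist_le h Kg) (L_dist_le1 _ _).
Qed.

Lemma L_delta_sub (R : realType) (S : Type) (K1 K2 : simplicial_complex S) :
  simplices K1 `<=` simplices K2 -> L_delta R K1 K2 <= 0.
Proof.
move=> K12; apply: L_delta_le => f [Kf aef].
by exists f; [split => //; exact: K12|rewrite L_distxx].
Qed.

(** * Complexes cut out by a hereditary property *)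

Definition hereditary (S : Type) (P : set (set S)) :=
  forall A B, P A -> B `<=` A -> P B.

Lemma hereditary_simplices_neq0 (S : Type) (P : set (set S)) :
  (exists s, P [set s]) -> [set A | fin_nonempty_sets S A /\ P A] !=set0.
Proof.
by move=> [s Ps]; exists [set s]; split => //; split => //; exists s.
Qed.

Lemma hereditary_simplices_sub (S : Type) (P : set (set S)) :
  hereditary P -> forall A B, fin_nonempty_sets S A /\ P A ->
  B `<=` A -> B !=set0 -> fin_nonempty_sets S B /\ P B.
Proof.
move=> hP A B [[finA _] PA] BA B0; split; last exact: hP BA.
by split => //; exact: sub_finite_set finA.
Qed.

Definition hereditary_complex (S : Type) (P : set (set S))
    (P1 : exists s, P [set s]) (hP : hereditary P) : simplicial_complex S :=
  @SimplicialComplex S [set A | fin_nonempty_sets S A /\ P A]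
    (hereditary_simplices_neq0 P1) (fun A => @proj1 _ _)
    (hereditary_simplices_sub hP).


Lemma hereditary_avoiding (S : Type) (T : set S) :
  hereditary [set A | ~ T `<=` A].
Proof. by move=> A B TA BA TB; apply: TA; exact: subset_trans TB BA. Qed.

Definition avoiding (S : Type) (T : set S) (T2 : exists s, ~ T `<=` [set s]) :
  simplicial_complex S := hereditary_complex T2 (@hereditary_avoiding S T).

Lemma hereditary_subsets (S : Type) (T : set S) : hereditary [set A | A `<=` T].
Proof. by move=> A B AT BA; exact: subset_trans BA AT. Qed.

(** The map g is f with the value t0 replaced by some other point t1. Its
essential image misses t0, hence does not contain T, whatever t1 is. *)
Lemma avoiding_near (R : realType) (S : Type) (K : simplicial_complex S)
    (T : set S) (T2 : exists s, ~ T `<=` [set s]) (f : ae_map R S) (t0 : S) :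
  L K f -> T t0 -> exists2 g : ae_map R S, L (avoiding T2) g &
    ((L_dist f g)%:E <= mass f [set t0])%E.
Proof.
move=> Kf Tt0.
(* A single point cannot contain T, so S has at least two points. *)
have [t1 t10] : exists t1, t1 <> t0.
  apply: contrapT => t0u; have [s] := T2; apply => t _.
  have tu u : u = t0 by apply: contrapT => ut0; apply: t0u; exists u.
  by rewrite (tu t) (tu s).
pose r s := if `[< s = t0 >] then t1 else s.
exists (postcomp r f); last first.
  by apply: L_dist_postcomp_le => s st0; rewrite /r; case: asboolP.
have [/simplices_fin[finA A0] _] := Kf; apply: (L_postcomp Kf).
split; first by split; [exact: finite_image|exact: image_nonempty].
move=> /(_ _ Tt0)[s _]; rewrite /r; by case: asboolP.
Qed.

Definition window (S : Type) (x : nat -> S) (n i : nat) : set S :=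
  [set x (i + k)%N | k in [set k | (k < n)%N]].

(** Comparing the first and the last points of the two windows forces both
j <= i and i <= j. *)
Lemma window_subset (S : Type) (x : nat -> S) (n i j : nat) :
  injective x -> (0 < n)%N -> window x n i `<=` window x n j -> i = j.
Proof.
move=> xinj n0 ij.
have [k kn /xinj ki] : window x n j (x (i + 0)%N) by apply: ij; exists 0%N.
have [l ln /xinj li] : window x n j (x (i + n.-1)%N).
  by apply: ij; exists n.-1 => //=; rewrite ltn_predL.
move: kn ln => /= kn ln; lia.
Qed.

Lemma window_not_singleton (S : Type) (x : nat -> S) (n i : nat) :
  injective x -> (1 < n)%N -> exists s, ~ window x n i `<=` [set s].
Proof.
move=> xinj n1; exists (x i) => /(_ (x (i + 1)%N)).
by move=> /(_ (ex_intro2 _ _ 1%N n1 erefl)) /xinj; lia.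
Qed.

(** The lower bound e has to be the same for all pairs of windows. It is obtained
once, from a random simplex with image the window at 0, which is then carried to
the window at j by a map of S extending x_k |-> x_(j+k). *)
Lemma avoiding_windows_separated (R : realType) (S : Type) (x : nat -> S)
    (n : nat) (W2 : forall i, exists s, ~ window x n i `<=` [set s]) :
  injective x -> (0 < n)%N ->
  exists2 e : R, 0 < e & forall i j, i <> j ->
    e <= L_delta R (avoiding (W2 i)) (avoiding (W2 j)).
Proof.
move=> xinj n0.
have W0 i : window x n i (x (i + 0)%N) by exists 0%N.
have finW i : finite_set (window x n i) by exact/finite_image/finite_II.
have P1 : exists s, [set A | A `<=` window x n 0] [set s].
  by exists (x (0 + 0)%N) => _ ->.
have : simplices (hereditary_complex P1 (@hereditary_subsets S (window x n 0)))
    (window x n 0).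
  by split => //; split => //; eexists; exact: W0.
move=> /(L_step R)[f Lf [e e0 fe]]; exists e => // i j ij.
(* A left inverse of x, with the junk value 0 off the range of x. *)
pose y s := xget 0%N [set k | x k = s].
have xK k : y (x k) = k by apply: xinj; apply: (@xgetPex _ 0%N [set l | x l = x k]); exists k.
pose r s := x (j + y s)%N.
have rW : r @` window x n 0 = window x n j.
  rewrite /window image_comp; apply: eq_imagel => k _ /=.
  by rewrite /r xK add0n.
(* The carried simplex lives on the window at j, so it avoids the one at i, but
   anything that avoids the window at j loses one of its points. *)
apply: (@le_L_delta _ _ _ _ (postcomp r f)).
  have [[[finA A0] AW] _] := Lf; apply: (L_postcomp Lf).
  split; first by split; [exact: finite_image|exact: image_nonempty].
  move=> WiA; apply: ij; apply: (window_subset xinj n0).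
  by apply: subset_trans WiA _; rewrite -rW; exact: image_subset.
move=> g [[_ avg] _].
have [s Ws ngs] : exists2 s, window x n j s & ~ ess_image g s.
  apply: contrapT => nex; apply: avg => s Ws; apply: contrapT => ngs.
  by apply: nex; exists s.
rewrite -lee_fin; apply: le_trans (le_mass_L_dist _ ngs).
move: Ws; rewrite -rW mass_postcomp => -[s' Ws' <-].
by apply: le_trans (fe _ Ws') _; apply: le_mass => _ ->.
Qed.

Definition full_complex (S : Type) (s0 : S) : simplicial_complex S :=
  @hereditary_complex S setT (ex_intro _ s0 I) (fun _ _ _ _ => I).

Lemma dist_full_avoiding_window (R : realType) (S : Type) (x : nat -> S)
    (n i : nat) (W2 : exists s, ~ window x n i `<=` [set s]) (s0 : S) :
  injective x -> (0 < n)%N ->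
  complex_dist R (full_complex s0) (avoiding W2) <= n%:R^-1.
Proof.
move=> xinj n0; rewrite /complex_dist ge_max; apply/andP; split; last first.
  apply: le_trans (L_delta_sub _ _) _ => [A [finA _]|]; first by split.
  by rewrite invr_ge0.
apply: L_delta_le => f Kf.
have [|k kn fk] := @small_mass R S f (fun k => x (i + k)%N) n _ n0.
  by move=> k l /xinj /addnI.
have [g Lg fg] := avoiding_near W2 Kf (ex_intro2 _ _ k kn erefl).
by exists g => //; rewrite -lee_fin; exact: le_trans fg fk.
Qed.

Theorem proposition3p2 (R : realType) (S : Type) :
  infinite_set [set: S] -> ~ locally_compact [set: complex_space R S].
Proof.
move=> /infiniteP/card_leP[x'] lcS.
pose x (k : nat) : S := val (x' (to_setT k)).
have xinj : injective x by move=> k l /val_inj /(inj (mem_set I) (mem_set I)) [].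
pose K0 : complex_space R S := full_complex (x 0%N).
have [U + [Ucpt _]] := lcS K0 I.
rewrite /within /= => /nbhs_ballP[e /= e0 eU].
have [n n1 ne] : exists2 n : nat, (1 < n)%N & n%:R^-1 < e.
  exists (Num.truncn e^-1).+2 => //.
  rewrite -[ltRHS]invrK ltf_pV2 ?posrE ?invr_gt0//.
  by apply: lt_trans (truncnS_gt _) _; rewrite ltr_nat.
have n0 := ltnW n1.
have W2 i := @window_not_singleton S x n i xinj n1.
have [d d0 sep] := @avoiding_windows_separated R S x n W2 xinj n0.
apply: (@compact_not_separated R (complex_space R S) U
  (fun i => avoiding (W2 i)) d d0) Ucpt.
  move=> i; apply: eU => //; rewrite ballEmdist /=.
  exact: le_lt_trans (dist_full_avoiding_window _ _ _ xinj n0) ne.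
by move=> i j ij; rewrite [leRHS]/(complex_dist _ _ _) le_max sep.
Qed.
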